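(* Let $G^*$ be the graph on $24$ vertices and let $S_{10}$ and $S_{12}$ be the cubic graphs on $10$ and $12$ vertices, respectively, defined in the context. Then $G^*$ is a cubic graph with a perfect matching that has neither an $S_{10}$-coloring nor an $S_{12}$-coloring. Hence both of the following assertions are false: (I) every cubic graph has an $S_{10}$-coloring; (II) every cubic graph with a perfect matching has an $S_{12}$-coloring.
   Context: Graphs are finite and may have parallel edges but no loops. For a graph $G$ and $v\in V(G)$, $\partial_G(v)$ denotes the set of edges of $G$ incident with $v$. Two distinct edges are adjacent if they share at least one end vertex (so parallel edges are adjacent). A graph is cubic if every vertex is incident with exactly three edges. A perfect matching is a set of pairwise non-adjacent edges such that every vertex is incident with an edge of the set. $H$-coloring: for graphs $G$ and $H$, an $H$-coloring of $G$ is a mapping $f\colon E(G)\to E(H)$ such that (1) if $e_1,e_2\in E(G)$ are adjacent, then $f(e_1)\neq f(e_2)$; (2) for every $v\in V(G)$ there exists a vertex $u\in V(H)$ with $f(\partial_G(v))=\partial_H(u)$. The graph $S_4$: it has vertices $x,y,z,w$; $x$ and $y$ are joined by two parallel edges, and the remaining edges are the single edges $xz$, $yz$, $zw$ (so $w$ has degree $1$ and $x,y,z$ have degree $3$). The graph $S_{10}$ (Sylvester graph): it has vertices $w$ and $x_i,y_i,z_i$ for $i=1,2,3$; for each $i\in\{1,2,3\}$, $x_i$ and $y_i$ are joined by two parallel edges, and there are single edges $x_iz_i$, $y_iz_i$, $z_iw$. There are no other edges. The graph $S_{12}$: it is obtained from $S_{10}$ by replacing the central vertex $w$ with a triangle,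 i.e. it has vertices $w_i,x_i,y_i,z_i$ for $i=1,2,3$; for each $i$, $x_i$ and $y_i$ are joined by two parallel edges, and there are single edges $x_iz_i$, $y_iz_i$, $z_iw_i$; in addition there are the edges $w_1w_2$, $w_2w_3$, $w_1w_3$. There are no other edges. The graph $G^*$: take a copy of the Petersen graph $P$ and choose a vertex $u$ of it (the choice is irrelevant up to isomorphism); let $h_1,h_2,h_3$ be the neighbours of $u$ in $P$. Subdivide each of the three edges incident with $u$ by one new vertex, and expand one of the three new vertices to a triangle; then attach a copy of $S_4$ to each of the three resulting vertices of degree $2$, by identifying the degree-$1$ vertex of the copy of $S_4$ with that vertex. Explicitly: delete the edges $uh_1,uh_2,uh_3$ from $P$; add vertices $s_1,s_2,t_1,t_2,t_3$ and the edges $us_1$, $s_1h_1$, $us_2$, $s_2h_2$, $ut_1$, $t_1t_2$, $t_2t_3$, $t_1t_3$, $t_2h_3$; finally, for each $q\in\{s_1,s_2,t_3\}$ add three new vertices $x^q,y^q,z^q$, two parallel edges joining $x^q$ and $y^q$, and the single edges $x^qz^q$, $y^qz^q$, $z^qq$. *)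

(* Defs.v *)
From mathcomp Require Import all_boot.

Set Implicit Arguments.
Unset Strict Implicit.
Unset Printing Implicit Defensive.

(* Parallel edges are distinct elements of [edge] with the same set of ends;
   the cardinality condition excludes loops. *)
Record multigraph := Multigraph {
  vertex : finType;
  edge : finType;
  ends : edge -> {set vertex};
  card_ends : forall e, #|ends e| = 2
}.

Definition incident_edges (G : multigraph) (v : vertex G) : {set edge G} :=
  [set e | v \in ends e].

Definition adjacent (G : multigraph) (e1 e2 : edge G) : bool :=
  (e1 != e2) && (ends e1 :&: ends e2 != set0).

Definition cubic (G : multigraph) : Prop :=
  forall v : vertex G, #|incident_edges v| = 3.

Definition perfect_matching (G : multigraph) (M : {set edge G}) : Prop :=
  {in M &, forall e1 e2, ~~ adjacent e1 e2} /\
  (forall v : vertex G, exists2 e, e \in M & e \in incident_edges v).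

Definition is_coloring (G H : multigraph) (f : edge G -> edge H) : Prop :=
  (forall e1 e2, adjacent e1 e2 -> f e1 <> f e2) /\
  (forall v : vertex G, exists u : vertex H,
     f @: incident_edges v = incident_edges u).

Definition has_coloring (H G : multigraph) : Prop :=
  exists f : edge G -> edge H, is_coloring f.

(* Graphs on the vertices 0, ..., n-1 given by a list of edges, in which a
   pair of vertices occurs once for each edge joining them. *)
Definition valid_edges (n : nat) (s : seq (nat * nat)) : bool :=
  all (fun p => [&& p.1 < n, p.2 < n & p.1 != p.2]) s.

Definition list_ends (n : nat) (s : seq (nat * nat)) (i : 'I_(size s)) :
    {set 'I_n} :=
  [set v : 'I_n | (v == (nth (0, 0) s i).1 :> nat)
               || (v == (nth (0, 0) s i).2 :> nat)].

Lemma card_list_ends (n : nat) (s : seq (nat * nat)) :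
  valid_edges n s -> forall i : 'I_(size s), #|list_ends n i| = 2.
Proof.
move=> /allP s_valid i.
have /s_valid/and3P[lt1 lt2 neq12] := mem_nth (0, 0) (ltn_ord i).
have -> : list_ends n i = [set Ordinal lt1; Ordinal lt2].
  by apply/setP=> v; rewrite !inE.
by rewrite cards2 -val_eqE /= neq12.
Qed.

Definition list_graph (n : nat) (s : seq (nat * nat)) (sP : valid_edges n s) :
    multigraph :=
  Multigraph (card_list_ends sP).

(* A copy of S_4 with vertices x, y, z, w, where w has degree 1. *)
Definition S4_edges (x y z w : nat) : seq (nat * nat) :=
  [:: (x, y); (x, y); (x, z); (y, z); (z, w)].

Definition S10_edges : seq (nat * nat) :=
  let w := 0 in
  let x1 := 1 in let y1 := 2 in let z1 := 3 in
  let x2 := 4 in let y2 := 5 in let z2 := 6 in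
  let x3 := 7 in let y3 := 8 in let z3 := 9 in
  S4_edges x1 y1 z1 w ++ S4_edges x2 y2 z2 w ++ S4_edges x3 y3 z3 w.

Definition S12_edges : seq (nat * nat) :=
  let w1 := 0 in let x1 := 1 in let y1 := 2 in let z1 := 3 in
  let w2 := 4 in let x2 := 5 in let y2 := 6 in let z2 := 7 in
  let w3 := 8 in let x3 := 9 in let y3 := 10 in let z3 := 11 in
  S4_edges x1 y1 z1 w1 ++ S4_edges x2 y2 z2 w2 ++ S4_edges x3 y3 z3 w3 ++
  [:: (w1, w2); (w2, w3); (w1, w3)].

(* Outer 5-cycle 0 1 2 3 4, spokes, inner pentagram 5 7 9 6 8. *)
Definition petersen_edges : seq (nat * nat) :=
  [:: (0, 1); (1, 2); (2, 3); (3, 4); (4, 0);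
      (0, 5); (1, 6); (2, 7); (3, 8); (4, 9);
      (5, 7); (7, 9); (9, 6); (6, 8); (8, 5)].

(* The vertex u = 0 of the Petersen graph has neighbours 1, 4 and 5; since
   the Petersen graph is vertex-transitive and the stabiliser of u acts on
   these neighbours as the full symmetric group, the choice of u and the order
   h1, h2, h3 do not matter. *)
Definition Gstar_edges : seq (nat * nat) :=
  let u := 0 in let h1 := 1 in let h2 := 4 in let h3 := 5 in
  let s1 := 10 in let s2 := 11 in
  let t1 := 12 in let t2 := 13 in let t3 := 14 in
  [seq p <- petersen_edges | (p.1 != u) && (p.2 != u)] ++
  [:: (u, s1); (s1, h1); (u, s2); (s2, h2);
      (u, t1); (t1, t2); (t2, t3); (t1, t3); (t2, h3)] ++
  S4_edges 15 16 17 s1 ++ S4_edges 18 19 20 s2 ++ S4_edges 21 22 23 t3.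

Definition S10 : multigraph := @list_graph 10 S10_edges isT.
Definition S12 : multigraph := @list_graph 12 S12_edges isT.
Definition Gstar : multigraph := @list_graph 24 Gstar_edges isT.

(* Main.v *)
Require Import Defs.
From mathcomp Require Import all_boot.

Set Implicit Arguments.
Unset Strict Implicit.
Unset Printing Implicit Defensive.

(** Everything rests on one assertion, that G* has no S_10-colouring.
    Indeed S_12 has an S_10-colouring, which sends each edge of the central
    triangle to the bridge at the opposite corner, and colourings compose; so
    an S_12-colouring of G* would yield an S_10-colouring.  As G* is cubic and
    has a perfect matching, it refutes both general assertions.

    Suppose that f is an S_10-colouring of G*.  The preimage under f of a set
    of edges that meets every star of S_10 evenly meets every star of G*
    evenly, and such a set contains no bridge of G*.  The double edges and the
    triangles of S_10 are even and cover every edge that is not a bridge.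
    Hence f maps the three bridges of G*, which join the pendant copies of S_4
    to s_1, s_2 and t_3, to bridges of S_10 ([bridge_color]).  After this, the
    three copies of S_4 can be forgotten: what is left is a question about the
    stars of the 15 core vertices, the ten of the Petersen graph together with
    s_1, s_2, t_1, t_2 and t_3.

    Call the edges x_i z_i and y_i z_i of S_10 legs.  If the stars of s_1, s_2
    and t_3 are all mapped to stars of vertices z_i, then u s_1 and u s_2 are
    mapped to legs, so u is mapped to some z_i as well and u t_1 to a bridge;
    then the edges t_1 t_3, t_2 t_3 and t_1 t_2 are mapped to legs of one
    z_k and are pairwise adjacent, although z_k has only two legs.  In the
    other cases s_1, s_2 or t_3 is mapped to w, and the rest of the Petersen
    graph comes into play.  An exhaustive search ([refute_core]), whose
    soundness is [refute_sound], disposes of all cases uniformly. *)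

(** * Colourings of multigraphs *)

Lemma incident_adjacent (G : multigraph) (v : vertex G) (e1 e2 : edge G) :
  v \in ends e1 -> v \in ends e2 -> e1 != e2 -> adjacent e1 e2.
Proof.
move=> ve1 ve2 ne12; rewrite /adjacent ne12.
by apply/set0Pn; exists v; rewrite inE ve1.
Qed.

Lemma adjacent_incident (G : multigraph) (e1 e2 : edge G) :
  adjacent e1 e2 ->
  e1 != e2 /\ exists2 v, e1 \in incident_edges v & e2 \in incident_edges v.
Proof.
case/andP=> ne12 /set0Pn[v]; rewrite inE => /andP[ve1 ve2].
by split=> //; exists v; rewrite inE.
Qed.

Lemma coloring_inj_star (G H : multigraph) (f : edge G -> edge H) v :
  is_coloring f -> {in incident_edges v &, injective f}.
Proof.
case=> f_adj _ e1 e2; rewrite !inE => ve1 ve2 eqf; apply/eqP/negPn/negP=> ne12.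
exact: f_adj (incident_adjacent ve1 ve2 ne12) eqf.
Qed.

(** Two adjacent edges lie in a common star, and f maps that star onto a star
    of the same size, hence injectively: between cubic graphs the condition on
    adjacent edges follows from the one on stars. *)
Lemma cubic_coloring (G H : multigraph) (f : edge G -> edge H) :
    cubic G -> cubic H ->
    (forall v, exists u, f @: incident_edges v = incident_edges u) ->
  is_coloring f.
Proof.
move=> cubG cubH f_star; split=> // e1 e2 /adjacent_incident[ne12 [v ve1 ve2]].
have [u fv] := f_star v.
have /imset_injP f_inj: #|f @: incident_edges v| == #|incident_edges v|.
  by rewrite fv cubG cubH.
by move/(f_inj _ _ ve1 ve2)/eqP; rewrite (negPf ne12).
Qed.

Lemma has_coloring_trans (H K G : multigraph) :
  has_coloring H K -> has_coloring K G -> has_coloring H G.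
Proof.
move=> [f fP] [g gP]; exists (f \o g); split=> [e1 e2 adj12|v].
  have [ne12 [v ve1 ve2]] := adjacent_incident adj12.
  have [u gv] := gP.2 v.
  move/(coloring_inj_star fP (v := u)).
  by rewrite -gv !imset_f // => /(_ isT isT); apply: gP.1.
have [u gv] := gP.2 v; have [w fu] := fP.2 u.
by exists w; rewrite imset_comp gv.
Qed.

Lemma one_edge_perfect_matching (G : multigraph) (M : {set edge G}) :
  (forall v, #|incident_edges v :&: M| = 1) -> perfect_matching M.
Proof.
move=> M1; split=> [e1 e2 Me1 Me2|v]; last first.
  have /eqP/cards1P[e /setP/(_ e)] := M1 v.
  by rewrite in_set1 eqxx inE => /andP[ve Me]; exists e.
apply/negP=> /adjacent_incident[ne12 [v ve1 ve2]].
have /eqP/cards1P[e /setP Me] := M1 v.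
have /[!(in_set1, inE)] := Me e1; have /[!(in_set1, inE)] := Me e2.
move: ve1 ve2; rewrite !inE Me1 Me2 => -> -> /esym/eqP e2e /esym/eqP e1e.
by rewrite e1e e2e eqxx in ne12.
Qed.

(** * Parity and bridges *)

(** These are the elements of the cycle space of H over the two-element
    field. *)
Definition even_edge_set (H : multigraph) (D : {set edge H}) : Prop :=
  forall u : vertex H, ~~ odd #|incident_edges u :&: D|.

(** A colouring maps each star bijectively onto a star, so the preimage of D
    meets the star of v in as many edges as D meets the image star. *)
Lemma even_edge_set_preim (G H : multigraph) (f : edge G -> edge H)
    (D : {set edge H}) :
  is_coloring f -> even_edge_set D -> even_edge_set (f @^-1: D).
Proof.
move=> fP evenD v; have [u fv] := fP.2 v.
have f_inj := coloring_inj_star fP (v := v).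
rewrite -(card_in_imset (f := f)); last first.
  by move=> e1 e2 /setIP[ve1 _] /setIP[ve2 _]; apply: f_inj.
suff ->: f @: (incident_edges v :&: f @^-1: D) = incident_edges u :&: D by [].
rewrite -fv; apply/setP=> c; rewrite inE; apply/imsetP/andP.
  by case=> e /setIP[ve]; rewrite inE => Dfe ->; rewrite imset_f.
by case=> /imsetP[e ve ->] Dfe; exists e; rewrite // in_setI ve inE.
Qed.

(** The hypothesis says that e0 is the only edge with exactly one end in X.
    Counting the pairs of a vertex of X and an edge of D at that vertex, first
    by vertices and then by edges, gives an even number that has the parity
    of the truth value of e0 \in D. *)
Lemma odd_cut_even_edge_set (G : multigraph) (X : {set vertex G}) (e0 : edge G)
    (D : {set edge G}) :
  (forall e, odd #|ends e :&: X| = (e == e0)) -> even_edge_set D -> e0 \notin D.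
Proof.
move=> cutX evenD.
have: ~~ odd (\sum_(v in X) #|incident_edges v :&: D|)%N.
  by elim/big_rec: _ => // v k _ even_k; rewrite oddD (negPf (evenD v)).
have -> : \sum_(v in X) #|incident_edges v :&: D|
          = \sum_(e in D) #|ends e :&: X|.
  have cardI (T : finType) (A B : {set T}) :
      #|A :&: B| = \sum_(x in B) (x \in A).
    rewrite -sum1_card big_mkcond [RHS]big_mkcond; apply: eq_bigr => x _.
    rewrite inE.
    by case: (x \in A); case: (x \in B).
  under eq_bigr do rewrite cardI; rewrite exchange_big /=.
  apply: eq_bigr => e _; rewrite cardI.
  by apply: eq_bigr => v _; rewrite inE.
apply: contraNN => De0; rewrite (bigD1 e0) //= oddD cutX eqxx.
elim/big_rec: _ => // e k /andP[_ ne] odd_k.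
by rewrite oddD cutX (negPf ne).
Qed.

Lemma bridge_color_notin_even (G H : multigraph) (f : edge G -> edge H)
    (X : {set vertex G}) (e0 : edge G) (D : {set edge H}) :
    is_coloring f -> (forall e, odd #|ends e :&: X| = (e == e0)) ->
  even_edge_set D -> f e0 \notin D.
Proof.
move=> fP cutX /(even_edge_set_preim fP)/(odd_cut_even_edge_set cutX).
by rewrite inE.
Qed.

(** * Graphs given by lists of edges *)

(** The finite sets in the definition of incidence do not compute; the lemmas
    below replace them by lists of edge numbers, on which finite checks are
    done by evaluation. *)

Lemma forall_ord_all n (P : pred nat) :
  all P (iota 0 n) -> forall i : 'I_n, P i.
Proof. by move/allP=> iotaP i; apply: iotaP; rewrite mem_iota ltn_ord. Qed.

Lemma card_ord_count n (P : pred nat) :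
  #|[set i : 'I_n | P i]| = count P (iota 0 n).
Proof.
rewrite -val_enum_ord count_map cardE enumT /enum_mem size_filter.
by apply: eq_count => i; rewrite !inE.
Qed.

Definition edges_at (s : seq (nat * nat)) (v : nat) : seq nat :=
  [seq i <- iota 0 (size s) |
     (v == (nth (0, 0) s i).1) || (v == (nth (0, 0) s i).2)].

Lemma enum_incident_edges n (s : seq (nat * nat)) (sP : valid_edges n s)
    (v : vertex (list_graph sP)) :
  [seq val (e : 'I_(size s)) | e <- enum (incident_edges v)] = edges_at s v.
Proof.
rewrite /edges_at -val_enum_ord filter_map enumT /enum_mem; congr map.
by apply: eq_filter => e; rewrite !inE.
Qed.

Lemma card_incident_edges n (s : seq (nat * nat)) (sP : valid_edges n s)
    (v : vertex (list_graph sP)) :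
  #|incident_edges v| = size (edges_at s v).
Proof. by rewrite -enum_incident_edges size_map -cardE. Qed.

Lemma card_incident_edgesI n (s : seq (nat * nat)) (sP : valid_edges n s)
    (v : vertex (list_graph sP)) (P : pred nat) :
  #|incident_edges v :&: [set e : edge (list_graph sP) | P (e : 'I_(size s))]|
   = count P (edges_at s v).
Proof.
rewrite -enum_incident_edges count_map cardE /enum_mem count_filter size_filter.
by apply: eq_count => e; rewrite !inE andbC.
Qed.

Lemma card_endsI n (s : seq (nat * nat)) (sP : valid_edges n s)
    (e : edge (list_graph sP)) (P : pred nat) :
  #|ends e :&: [set v : vertex (list_graph sP) | P (v : 'I_n)]| =
  count (fun v => ((v == (nth (0, 0) s (e : 'I_(size s))).1)
               || (v == (nth (0, 0) s (e : 'I_(size s))).2)) && P v) (iota 0 n).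
Proof.
rewrite -card_ord_count; congr #|pred_of_set _|.
by apply/setP=> v; rewrite !inE.
Qed.

Lemma cubic_list_graph n s (sP : valid_edges n s) :
  all (fun v => size (edges_at s v) == 3) (iota 0 n) -> cubic (list_graph sP).
Proof.
move=> deg3 v; rewrite card_incident_edges.
by apply/eqP/(forall_ord_all deg3).
Qed.

(** Each star occurs with its edges in every order, because the lists below
    follow the order of the edges of the coloured graph. *)
Definition stars n s : seq (seq nat) :=
  flatten [seq permutations (edges_at s u) | u <- iota 0 n].

Lemma map_edges_at m n s t (sP : valid_edges m s) (tP : valid_edges n t)
    (f : edge (list_graph sP) -> edge (list_graph tP)) (g : nat -> nat)
    (v : vertex (list_graph sP)) :
    (forall e, val (f e : 'I_(size t)) = g (val (e : 'I_(size s)))) ->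
  [seq g e | e <- edges_at s (v : 'I_m)]
    = [seq val (c : 'I_(size t)) | c <- map f (enum (incident_edges v))].
Proof.
move=> fg; rewrite -enum_incident_edges -!map_comp.
by apply: eq_map => e /=; rewrite fg.
Qed.

(** This turns a colouring into a solution, in numbers, of the constraints to
    which the exhaustive search applies; [list_coloring] is the opposite
    passage. *)
Lemma coloring_stars m n s t (sP : valid_edges m s) (tP : valid_edges n t)
    (f : edge (list_graph sP) -> edge (list_graph tP)) (g : nat -> nat) v :
    (forall e, val (f e : 'I_(size t)) = g (val (e : 'I_(size s)))) ->
    is_coloring f -> v < m ->
  [seq g e | e <- edges_at s v] \in stars n t.
Proof.
move=> fg fP lt_vm; have [u fv] := fP.2 (Ordinal lt_vm).
apply/flattenP; exists (permutations (edges_at t (u : 'I_n))).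
  by apply: map_f; rewrite mem_iota ltn_ord.
rewrite mem_permutations (map_edges_at (Ordinal lt_vm) fg).
rewrite -enum_incident_edges.
apply/perm_map/uniq_perm; rewrite ?enum_uniq //.
  rewrite map_inj_in_uniq ?enum_uniq // => e1 e2; rewrite !mem_enum.
  exact: coloring_inj_star fP _ _.
move=> c; rewrite mem_enum -fv; apply/mapP/imsetP=> -[e ve ->]; exists e => //.
  by rewrite mem_enum in ve.
by rewrite mem_enum.
Qed.

Lemma list_coloring m n s t (sP : valid_edges m s) (tP : valid_edges n t)
    (f : edge (list_graph sP) -> edge (list_graph tP)) (g : nat -> nat) :
    (forall e, val (f e : 'I_(size t)) = g (val (e : 'I_(size s)))) ->
    cubic (list_graph sP) -> cubic (list_graph tP) ->
    all (fun v => has (fun u => perm_eq (map g (edges_at s v)) (edges_at t u))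
                      (iota 0 n)) (iota 0 m) ->
  is_coloring f.
Proof.
move=> fg cubs cubt g_stars; apply: cubic_coloring => // v.
have /hasP[u] := forall_ord_all g_stars v; rewrite mem_iota => /= lt_un.
rewrite (map_edges_at v fg) -(@enum_incident_edges _ _ tP (Ordinal lt_un)).
move/(perm_map_inj val_inj)/perm_mem=> fv; exists (Ordinal lt_un).
apply/setP=> c; have := fv c; rewrite mem_enum => <-.
by apply/imsetP/mapP=> -[e ve ->]; exists e; rewrite // mem_enum in ve *.
Qed.

(** * Exhaustive search *)

Fixpoint lookup (a : seq (nat * nat)) (x : nat) : option nat :=
  if a is (y, c) :: a' then if x == y then Some c else lookup a' x else None.

Definition compatible (o : option nat) (c : nat) : bool :=
  if o is Some c' then c == c' else true.

(** A constraint (xs, ts) asks that the values of the variables xs form one of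
    the lists in ts, and a lists the values already chosen.  The result true
    means that all branches of the backtracking search die.  The conditional
    cannot be replaced by a Boolean connective: under call by value, this
    would explore the incompatible branches as well. *)
Fixpoint refute (cs : seq (seq nat * seq (seq nat))) (a : seq (nat * nat)) :=
  if cs is (xs, ts) :: cs' then
    let os := map (lookup a) xs in
    all (fun t => if all2 compatible os t then refute cs' (zip xs t ++ a)
                  else true) ts
  else false.

Lemma lookup_compatible (g : nat -> nat) (a : seq (nat * nat)) (x : nat) :
  (forall p, p \in a -> p.2 = g p.1) -> compatible (lookup a x) (g x).
Proof.
elim: a => //= -[y c] a IH ga; case: eqP => [->|_] /=.
  by have /= -> := ga (y, c) (mem_head _ _).
by apply: IH => p pa; apply: ga; rewrite inE pa orbT.
Qed.

(** A solution g that extends a survives along the branch that chooses the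
    values of g at each step. *)
Lemma refute_sound (g : nat -> nat) (cs : seq (seq nat * seq (seq nat)))
    (a : seq (nat * nat)) :
    (forall c, c \in cs -> map g c.1 \in c.2) ->
    (forall p, p \in a -> p.2 = g p.1) ->
  refute cs a = false.
Proof.
elim: cs a => //= -[xs ts] cs IH a gcs ga.
apply/negbTE/allPn; exists (map g xs) => /=.
  by apply: (gcs (xs, ts)); rewrite mem_head.
rewrite ifT; last first.
  by elim: (xs) => //= x xs' ->; rewrite andbT; apply: lookup_compatible.
rewrite IH // => [c c_cs|p]; first by apply: gcs; rewrite inE c_cs orbT.
rewrite mem_cat => /orP[|/ga //].
by elim: (xs) => //= x xs' IHxs; rewrite inE => /predU1P[->|].
Qed.

(** * The graph G* has no S_10-colouring *)

(** Numbers of the edges z_i w in the list of edges of S_10. *)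
Definition S10_bridges : seq nat := [:: 4; 9; 14].

(** For each pendant copy of S_4, its first vertex x and the number of the
    bridge that ends it; its vertices other than the end of the bridge in the
    core are x, x + 1 and x + 2. *)
Definition Gstar_gadgets : seq (nat * nat) := [:: (15, 25); (18, 30); (21, 35)].

(** In each of the three branches of S_10, the edges have the numbers 5i, ...,
    5i + 4: the double edge is formed by residues 0 and 1 modulo 5, a triangle
    by 0, 2 and 3, and the bridge has residue 4. *)
Lemma even_S10 (r : seq nat) :
    r \in [:: [:: 0; 1]; [:: 0; 2; 3]] ->
  even_edge_set [set e : edge S10 | (e : 'I_15) %% 5 \in r].
Proof.
move=> r_in u; rewrite (card_incident_edgesI u (fun i => i %% 5 \in r)).
apply: (@forall_ord_all 10 (fun u => ~~ odd (count _ (edges_at S10_edges u)))).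
by move: r_in; rewrite !inE => /orP[]/eqP->; vm_compute.
Qed.

Definition gadget_vertices (x : nat) : {set vertex Gstar} :=
  [set v : vertex Gstar | x <= (v : 'I_24) < x + 3].

Lemma gadget_cut x b (e : edge Gstar) :
    (x, b) \in Gstar_gadgets ->
  odd #|ends e :&: gadget_vertices x| = (val (e : 'I_36) == b).
Proof.
move=> xb; apply/eqP; rewrite (card_endsI e (fun v => x <= v < x + 3)).
pose P e := odd (count (fun v => ((v == (nth (0, 0) Gstar_edges e).1)
               || (v == (nth (0, 0) Gstar_edges e).2)) && (x <= v < x + 3))
               (iota 0 24)) == (e == b).
apply: (@forall_ord_all 36 P).
by rewrite /P {P}; move: xb; rewrite !inE => /or3P[]/eqP[-> ->]; vm_compute.
Qed.

(** The bridge of the gadget is the only edge that leaves it, so its colour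
    avoids the double edges and the triangles of S_10. *)
Lemma bridge_color (f : edge Gstar -> edge S10) x b :
    is_coloring f -> (x, b) \in Gstar_gadgets ->
  forall e : edge Gstar, val (e : 'I_36) = b -> val (f e : 'I_15) \in S10_bridges.
Proof.
move=> fP xb e0 def_b.
have not_even r : r \in [:: [:: 0; 1]; [:: 0; 2; 3]] ->
    (f e0 : 'I_15) %% 5 \notin r.
  move=> /even_S10 evenD.
  suff: f e0 \notin [set c : edge S10 | (c : 'I_15) %% 5 \in r] by rewrite inE.
  apply: (bridge_color_notin_even (X := gadget_vertices x)) fP _ evenD => e.
  by rewrite (gadget_cut e xb) -def_b val_eqE.
pose P c := (c %% 5 \notin [:: 0; 1]) ==> (c %% 5 \notin [:: 0; 2; 3])
             ==> (c \in S10_bridges).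
have: P (f e0 : 'I_15) by apply: forall_ord_all; vm_compute.
by rewrite /P !not_even.
Qed.

(** The order of the vertices keeps the search small: each vertex after the
    first has a coloured edge before it is treated, and the cycles of the
    Petersen graph are closed early. *)
Definition core_constraints :=
  [seq ([:: xb.2], [seq [:: c] | c <- S10_bridges]) | xb <- Gstar_gadgets] ++
  [seq (edges_at Gstar_edges v, stars 10 S10_edges) |
     v <- [:: 10; 0; 11; 12; 14; 13; 1; 6; 9; 4; 3; 2; 7; 8; 5]].

Lemma refute_core : refute core_constraints [::].
Proof. by vm_compute. Qed.

Lemma Gstar_not_S10 : ~ has_coloring S10 Gstar.
Proof.
case=> f fP.
(* On edge numbers of G* the default value 0 does not occur. *)
pose g i := oapp (fun e : 'I_36 => val (f e : 'I_15)) 0 (insub i).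
have fg (e : edge Gstar) : val (f e : 'I_15) = g (val (e : 'I_36)).
  by rewrite /g valK.
have := refute_core.
rewrite (refute_sound (g := g)) // => c.
rewrite mem_cat => /orP[] /mapP[].
  case=> x b xb ->; have lt_b: b < 36.
    by move: xb; rewrite !inE => /or3P[]/eqP[_ ->].
  have gb := bridge_color fP xb (e := Ordinal lt_b) erefl.
  by rewrite (fg (Ordinal lt_b)) in gb; exact: (map_f (fun c => [:: c]) gb).
move=> v v_core ->; have lt_v: v < 24.
  exact: (allP (a := fun v => v < 24)) v_core.
exact: (coloring_stars (f := f) fg fP lt_v).
Qed.

(** * The perfect matching, and the reduction from S_12 to S_10 *)

Lemma cubic_Gstar : cubic Gstar.
Proof. by apply: cubic_list_graph; vm_compute. Qed.

Lemma cubic_S10 : cubic S10.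
Proof. by apply: cubic_list_graph; vm_compute. Qed.

Lemma cubic_S12 : cubic S12.
Proof. by apply: cubic_list_graph; vm_compute. Qed.

Definition Gstar_matching : seq nat :=
  [:: 0; 2; 8; 10; 16; 20; 21; 25; 26; 30; 31; 35].

Lemma Gstar_perfect_matching :
  perfect_matching [set e : edge Gstar | val (e : 'I_36) \in Gstar_matching].
Proof.
apply: one_edge_perfect_matching => v.
rewrite (card_incident_edgesI v (fun i => i \in Gstar_matching)).
pose P v := count (fun i => i \in Gstar_matching) (edges_at Gstar_edges v) == 1.
by apply/eqP; apply: (@forall_ord_all 24 P); vm_compute.
Qed.

(** The pendant branches of S_12 have the same edge numbers as those of S_10;
    the edges w1w2, w2w3, w1w3 go to the bridges z3w, z1w, z2w.  Thus the star
    of each w_i goes to the star of w. *)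
Definition S12_to_S10 : seq nat := iota 0 15 ++ [:: 14; 4; 9].

Lemma S12_has_S10_coloring : has_coloring S10 S12.
Proof.
pose f (e : edge S12) : edge S10 := inord (nth 0 S12_to_S10 (e : 'I_18)) : 'I_15.
exists f; apply: (@list_coloring _ _ _ _ _ _ _ (nth 0 S12_to_S10)).
- move=> e; rewrite /= inordK //.
  by apply: (@forall_ord_all 18 (fun i => nth 0 S12_to_S10 i < 15)).
- exact: cubic_S12.
- exact: cubic_S10.
- by vm_compute.
Qed.

Theorem mainTheorem2 :
  [/\ cubic Gstar,
      exists M : {set edge Gstar}, perfect_matching M,
      ~ has_coloring S10 Gstar
    & ~ has_coloring S12 Gstar] /\
  ~ (forall G : multigraph, cubic G -> has_coloring S10 G) /\
  ~ (forall G : multigraph,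
       cubic G -> (exists M : {set edge G}, perfect_matching M) ->
       has_coloring S12 G).
Proof.
have pmG : exists M : {set edge Gstar}, perfect_matching M.
  by eexists; apply: Gstar_perfect_matching.
have not12 : ~ has_coloring S12 Gstar.
  by move/(has_coloring_trans S12_has_S10_coloring)/Gstar_not_S10.
split; first by split=> //; [apply: cubic_Gstar | apply: Gstar_not_S10].
split=> colorable; first exact/Gstar_not_S10/colorable/cubic_Gstar.
exact/not12/colorable/pmG/cubic_Gstar.
Qed.
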